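(* Let $k\ge 1$ be an integer, let $G$ be a connected triangle-free graph on $n$ vertices, and let $v\in V(G)$. If $G$ contains no induced subgraph on $k+1$ vertices that is a tree containing $v$, then $n\le 1+\frac{(k-1)k}{2}$. Further, equality $n=1+\frac{(k-1)k}{2}$ holds only if $G$ is isomorphic to $G_k$ via an isomorphism mapping $v$ to $v_0$.
   Context: All graphs are simple and finite. For $k\ge 1$, $G_k$ is the bipartite graph obtained from the path $P^k=v_0v_1\ldots v_{k-1}$ by replacing, for each $1\le i\le k-1$, the vertex $v_i$ by $k-i$ independent vertices (each copy of $v_i$ being adjacent to every copy of $v_{i-1}$ and of $v_{i+1}$), while $v_0$ remains a single vertex. Thus $|G_k|=1+\frac{(k-1)k}{2}$. *)

(* Defs.v *)
From mathcomp Require Import all_boot.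
Set Implicit Arguments. Unset Strict Implicit. Unset Printing Implicit Defensive.

Section Graphs.
Variable T : finType.

Definition simple_graph (e : rel T) := symmetric e /\ irreflexive e.

Definition connected_graph (e : rel T) := forall x y : T, connect e x y.

Definition triangle_free (e : rel T) :=
  forall x y z : T, ~ [&& e x y, e y z & e z x].

Definition induced_rel (e : rel T) (S : {set T}) : rel T :=
  [rel x y | [&& x \in S, y \in S & e x y]].

Definition acyclic_rel (r : rel T) :=
  forall c : seq T, 3 <= size c -> ~~ ucycleb r c.

Definition induced_tree (e : rel T) (S : {set T}) :=
  (forall x y, x \in S -> y \in S -> connect (induced_rel e S) x y) /\
  acyclic_rel (induced_rel e S).
End Graphs.

(* The graph G_k: vertex (i, j) is the j-th copy of v_i; v_0 has one copy
   (0,0), v_i (1 <= i <= k-1) has k - i copies. Copies of v_i and v_{i'} are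
   adjacent iff |i - i'| = 1. *)
Definition gk_ok (k : nat) (p : 'I_k * 'I_k) : bool :=
  if p.1 == 0 :> nat then p.2 == 0 :> nat else (nat_of_ord p.2 < k - nat_of_ord p.1)%N.

Definition gk_vert (k : nat) := {p : 'I_k * 'I_k | @gk_ok k p}.

Definition gk_adj (k : nat) : rel (gk_vert k) :=
  fun a b => ((val a).1.+1 == (val b).1 :> nat) || ((val b).1.+1 == (val a).1 :> nat).

(* Main.v *)
Require Import Defs.
From Stdlib Require Classical_Prop.
From mathcomp Require Import all_boot zify.
Set Implicit Arguments. Unset Strict Implicit. Unset Printing Implicit Defensive.

(** Induction on the number of vertices. Let [N] be the set of the [d] neighbours
    of [v], let [C] range over the components of [G - v - N], let [N_C] be the set
    of vertices of [N] with a neighbour in [C], and let [s_C] be the least [s] with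
    [2|C| <= s(s+1)]. By induction every [a] in [N_C] is the root of an induced tree
    on [s_C + 1] vertices in [a + C]. Gluing such trees to the star at [v] shows,
    for [A] included in [N], that [1 + |A| + sum s_C <= k] where the sum is over
    the components with exactly one attachment in [A].

    Taking [A = N] gives [d <= k - 1], and taking singletons shows that every [a]
    satisfies [sum_(C | a in N_C) s_C <= k - 2]. Hence the [N_C], with
    multiplicities [s_C], split into [k - 2] families in which every member has a
    private element; each such family satisfies [sum (s_C + 1) <= k - 1], so
    [sum s_C (s_C + 1) <= (k - 2)(k - 1)], and the bound follows.

    In the case of equality, double counting yields [|N_C| = s_C + 1], then the
    sets [N_C] are laminar and any two elements of [N] lie in a common one, so there
    is a single component [C], with [N_C = N]. By induction each [w + C] is a copy
    of [G_(k-1)], and all [w] in [N] have the same neighbours in [C]. *)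

(** * Irredundant subfamilies and packing by multiplicities *)

Section SetFamilies.
Variables (E I : finType) (N : I -> {set E}).

Definition irredundant (J : {set I}) :=
  forall i, i \in J -> exists2 a, a \in N i & forall j, j \in J -> a \in N j -> j = i.

(** Take [J] minimal by inclusion among the covers: dropping [i] leaves some element uncovered, and
    that element is private to [i]. *)
Lemma irredundant_subcover (P : {set I}) :
  exists J : {set I}, [/\ J \subset P, irredundant J &
    forall i a, i \in P -> a \in N i -> exists2 j, j \in J & a \in N j].
Proof.
pose cov := [pred J : {set I} | [forall i in P, N i \subset \bigcup_(j in J) N j]].
have covP : cov P by apply/forall_inP => i iP; apply: bigcup_sup.
have [J /minsetP [covJ minJ] JP] := minset_exists covP.
have covE i a : i \in P -> a \in N i -> exists2 j, j \in J & a \in N j.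
  move=> iP ai; have /subsetP /(_ _ ai) := forall_inP covJ i iP.
  by case/bigcupP => j; exists j.
exists J; split => // i iJ.
have : ~~ cov (J :\ i).
  apply/negP => /minJ /(_ (subD1set _ _)) /setP /(_ i).
  by rewrite !inE eqxx iJ.
case/forall_inPn => i' i'P /subsetPn [a ai' /bigcupP nota].
have unique j : j \in J -> a \in N j -> j = i.
  by move=> jJ aj; apply/eqP/negPn/negP => ji; apply: nota; exists j; rewrite // !inE ji.
by have [j jJ aj] := covE _ _ i'P ai'; exists a => //; rewrite -(unique j).
Qed.

(* Peeling off an irredundant subcover of the sets with positive multiplicity
   lowers every nonzero load, so [K] rounds exhaust the multiplicities. *)
Lemma irredundant_packing (P : {set I}) (w : I -> nat) (B K : nat) (s : I -> nat) :
  (forall i, i \in P -> N i != set0) ->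
  (forall J : {set I}, J \subset P -> irredundant J -> \sum_(i in J) w i <= B) ->
  (forall a, \sum_(i in P | a \in N i) s i <= K) ->
  \sum_(i in P) s i * w i <= K * B.
Proof.
move=> N0 wB; elim: K s => [|K IHK] s load.
  rewrite mul0n leqn0; apply/eqP/big1 => i iP.
  have /set0Pn [a ai] := N0 i iP.
  by have := load a; rewrite (bigD1 i) ?iP //= leqn0 addn_eq0 => /andP [/eqP -> _].
have [J [/subsetP JP irrJ covJ]] := irredundant_subcover [set i in P | 0 < s i].
have JP' : J \subset P by apply/subsetP => i /JP; rewrite inE => /andP [].
(* Every index in [J] has positive multiplicity, so this truncated subtraction is exact. *)
pose s' i := s i - (i \in J).
have sE i : s i = s' i + (i \in J).
  rewrite /s'; case: (boolP (i \in J)) => [/JP|]; rewrite ?inE; lia.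
have sumJ (F : I -> nat) : \sum_(i in P) (i \in J) * F i = \sum_(i in J) F i.
  rewrite (big_setID J) /= (setIidPr JP') [X in _ + X]big1 ?addn0.
    by apply: eq_bigr => i ->; rewrite mul1n.
  by move=> i; rewrite !inE => /andP [/negbTE ->].
rewrite (eq_bigr (fun i => s' i * w i + (i \in J) * w i)); last first.
  by move=> i _; rewrite {1}sE mulnDl.
rewrite big_split sumJ /= mulSn addnC leq_add ?wB //.
apply: IHK => a.
case: (posnP (\sum_(i in P | a \in N i) s i)) => [s0|].
  rewrite (leq_trans (n := \sum_(i in P | a \in N i) s i)) ?s0 //.
  by rewrite -[X in _ <= X]s0; apply: leq_sum => i _; apply: leq_subr.
rewrite lt0n sum_nat_eq0 negb_forall => /existsP [i].
rewrite negb_imply -lt0n => /andP [/andP [iP ai] si].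
have [|j jJ aj] := covJ i a _ ai; first by rewrite inE iP.
have jP := subsetP JP' _ jJ.
have := load a; rewrite !(bigD1 j (P := fun i => (i \in P) && (a \in N i))) ?jP //=.
have := sE j; rewrite jJ.
have : \sum_(i | (i \in P) && (a \in N i) && (i != j)) s' i
         <= \sum_(i | (i \in P) && (a \in N i) && (i != j)) s i.
  by apply: leq_sum => l _; apply: leq_subr.
lia.
Qed.

Lemma eq_from_leq_sum (P : {set I}) (F G : I -> nat) :
  (forall i, i \in P -> F i <= G i) ->
  \sum_(i in P) G i <= \sum_(i in P) F i -> forall i, i \in P -> F i = G i.
Proof.
move=> FG + i iP; rewrite !(bigD1 (P := fun i => i \in P) i iP) /=.
have := FG i iP.
have : \sum_(j in P | j != i) F j <= \sum_(j in P | j != i) G j.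
  by apply: leq_sum => j /andP [/FG].
lia.
Qed.

(** * Bounds that follow from the tree-gluing inequality, abstracted as [unique_hits] *)

Section UniqueHits.
Variables (k : nat) (M : {set E}) (P : {set I}) (s : I -> nat).

Hypothesis NM : forall i, i \in P -> N i \subset M.
Hypothesis N0 : forall i, i \in P -> N i != set0.
Hypothesis unique_hits : forall (A : {set E}) (J : {set I}),
  A \subset M -> J \subset P -> (forall i, i \in J -> #|N i :&: A| = 1) ->
  1 + #|A| + \sum_(i in J) s i <= k.

Lemma card_ground : #|M| <= k - 1.
Proof.
have := @unique_hits M set0 (subxx _) (sub0set _).
rewrite big_set0 => /(_ _); rewrite addn0 => H.
have {}H : 1 + #|M| <= k by apply: H => i; rewrite inE.
lia.
Qed.

Lemma load_bound a : \sum_(i in P | a \in N i) s i <= k - 2.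
Proof.
case: (boolP (a \in M)) => aM; last first.
  rewrite big1 // => i /andP [iP ai].
  by rewrite (subsetP (NM iP) _ ai) in aM.
have /(_ _) := @unique_hits [set a] [set i in P | a \in N i].
rewrite sub1set cards1 => H.
have {}H := H aM.
rewrite (eq_bigl (fun i => i \in [set i in P | a \in N i])); last by move=> i; rewrite inE.
suff : 1 + 1 + \sum_(i in [set i in P | a \in N i]) s i <= k by lia.
apply: H => [|i]; first by apply/subsetP => i; rewrite inE => /andP [].
by rewrite inE => /andP [_ ai]; rewrite (setIidPr _) ?sub1set // cards1.
Qed.

(** Let [A] consist of one private element for each member of [J]. It meets each [N i] exactly once
    and has [#|J|] elements, which account for the successors in the sum. *)
Lemma irredundant_weight (J : {set I}) :
  J \subset P -> irredundant J -> \sum_(i in J) (s i).+1 <= k - 1.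
Proof.
move=> JP irrJ.
have [->|[i0 i0J]] := set_0Vmem J; first by rewrite big_set0.
have [a0 _ _] := irrJ _ i0J.
pose priv i a := (a \in N i) && [forall j in J, (a \in N j) ==> (j == i)].
(* [a0] is only a default value: for [i] in [J] the pick succeeds by irredundancy. *)
pose r i := odflt a0 [pick a | priv i a].
have rP i : i \in J -> r i \in N i /\ (forall j, j \in J -> r i \in N j -> j = i).
  move=> iJ; rewrite /r; case: pickP => [a /andP [ai /forall_inP u]|] /=.
    by split=> // j jJ aj; have := u j jJ; rewrite aj => /eqP.
  have [a ai u] := irrJ _ iJ; move/(_ a); rewrite /priv ai /= => /negP [].
  by apply/forall_inP => j jJ; apply/implyP => aj; apply/eqP/u.
have rinj : {in J &, injective r}.
  move=> i j iJ jJ rij; have [_ u] := rP _ jJ.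
  by apply: u => //; rewrite -rij; have [] := rP _ iJ.
have := @unique_hits (r @: J) J.
rewrite (card_in_imset rinj) => H.
have {}H : 1 + #|J| + \sum_(i in J) s i <= k.
  apply: H => //.
    apply/subsetP => a /imsetP [i iJ ->].
    by apply: (subsetP (NM (subsetP JP _ iJ))); have [] := rP _ iJ.
  move=> i iJ; have [ri _] := rP _ iJ.
  suff -> : N i :&: r @: J = [set r i] by rewrite cards1.
  apply/setP => a; rewrite !inE; apply/andP/eqP => [[ai /imsetP [j jJ aE]]|->].
    by have [_ u] := rP _ jJ; rewrite aE (u i) // -aE.
  by split=> //; apply: imset_f.
rewrite (eq_bigr (fun i => 1 + s i)) // big_split /= sum1_card; lia.
Qed.

Lemma weight_bound : \sum_(i in P) s i * (s i).+1 <= (k - 2) * (k - 1).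
Proof.
apply: irredundant_packing => // [J JP irrJ|a]; first exact: irredundant_weight.
exact: load_bound.
Qed.

(** * Families attaining the weight bound *)

Section Extremal.
Hypothesis k_gt2 : 2 < k.
Hypothesis cardM : #|M| = k - 1.
Hypothesis sumP : \sum_(i in P) s i * (s i).+1 = (k - 2) * (k - 1).
Hypothesis s_gt0 : forall i, i \in P -> 0 < s i.

(** Apply [unique_hits] to [[set i]], with [A] everything outside [N i] together with one element of
    [N i]. *)
Lemma card_N_gt i : i \in P -> s i < #|N i|.
Proof.
move=> iP; have /set0Pn [a ai] := N0 iP.
have := @unique_hits (a |: (M :\: N i)) [set i].
rewrite big_set1 cardsU1 !inE ai cardsD (setIidPr (NM iP)) => H.
have le := subset_leq_card (NM iP).
suff : 1 + (true + (#|M| - #|N i|)) + s i <= k by lia.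
apply: H; rewrite ?sub1set //.
  by rewrite subUset sub1set subsetDl (subsetP (NM iP)).
move=> j; rewrite inE => /eqP ->; apply/eqP/cards1P; exists a; apply/setP => z.
rewrite !inE; case: (eqVneq z a) => [->|_]; first by rewrite ai.
by case: (z \in N i).
Qed.

Lemma sum_loads :
  \sum_(a in M) \sum_(i in P | a \in N i) s i = \sum_(i in P) s i * #|N i|.
Proof.
rewrite (exchange_big_dep (fun i => i \in P)) => [|a i _ /andP [] //].
apply: eq_bigr => i iP /=; rewrite sum_nat_cond_const mulnC; congr (_ * _).
apply: eq_card => a; rewrite !inE iP /=.
by apply: andb_idl; apply: (subsetP (NM iP)).
Qed.

(** Double counting the loads gives [s i * #|N i|] summing to at most (k - 1)(k - 2), which is the
    sum of the termwise smaller [s i * (s i).+1]. Hence all terms agree. *)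
Lemma extremal_card i : i \in P -> #|N i| = (s i).+1.
Proof.
move=> iP.
have := @eq_from_leq_sum P (fun i => s i * (s i).+1) (fun i => s i * #|N i|).
move=> /(_ _ _ i iP) /= H; apply/eqP; rewrite -(eqn_pmul2l (s_gt0 iP)) eq_sym.
apply/eqP/H => [j jP|]; first by rewrite leq_mul2l card_N_gt ?orbT.
rewrite -sum_loads sumP -cardM mulnC -sum_nat_const.
by apply: leq_sum => a _; apply: load_bound.
Qed.

Lemma extremal_load a : a \in M -> \sum_(i in P | a \in N i) s i = k - 2.
Proof.
move=> aM.
have sumM : \sum_(a in M) \sum_(i in P | a \in N i) s i = #|M| * (k - 2).
  rewrite sum_loads cardM mulnC -sumP.
  by apply: eq_bigr => i /extremal_card ->.
have lt := load_bound a.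
have : \sum_(b in M | b != a) \sum_(i in P | b \in N i) s i <= \sum_(b in M | b != a) (k - 2).
  by apply: leq_sum => b _; apply: load_bound.
move: sumM; rewrite -sum_nat_const !(bigD1 (P := fun a => a \in M) a aM) /=; lia.
Qed.

(** With [x] and [y] witnessing the two non-inclusions, let [A] be [x], [y] and everything outside
    the union. Then [unique_hits] gives the union at least s_i + s_j + 2 elements, the sum of the
    two cardinals, so nothing is shared. *)
Lemma extremal_laminar i j : i \in P -> j \in P ->
  ~~ (N i \subset N j) -> ~~ (N j \subset N i) -> [disjoint N i & N j].
Proof.
move=> iP jP /subsetPn [x xi xj] /subsetPn [y yj yi].
have ij : i != j by apply: contraNneq xj => <-.
have xy : x != y by apply: contraNneq xj => ->.
have UM : N i :|: N j \subset M by rewrite subUset !NM.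
have := @unique_hits ([set x; y] :|: (M :\: (N i :|: N j))) [set i; j].
rewrite big_setU1 ?inE // big_set1 => H.
rewrite -setI_eq0 -cards_eq0.
have cA : #|[set x; y] :|: (M :\: (N i :|: N j))| = 2 + (#|M| - #|N i :|: N j|).
  rewrite cardsU cards2 xy cardsD (setIidPr UM) [X in _ - X](_ : _ = 0) ?subn0 //.
  apply/eqP; rewrite cards_eq0 -subset0; apply/subsetP => z; rewrite !inE.
  by case/andP => /orP [] /eqP ->; rewrite ?xi ?yj ?orbT.
have := subset_leq_card UM; have := cardsUI (N i) (N j).
rewrite !extremal_card // cA in H *.
suff : 1 + (2 + (#|M| - #|N i :|: N j|)) + (s i + s j) <= k by lia.
apply: H.
- apply/subsetP => z; rewrite !inE => /orP [/orP [] /eqP ->|/andP [] //].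
    exact: (subsetP (NM iP)).
  exact: (subsetP (NM jP)).
- by apply/subsetP => z; rewrite !inE => /orP [] /eqP ->.
move=> l; rewrite !inE => /orP [] /eqP ->; apply/eqP/cards1P; [exists x|exists y].
  apply/setP => z; rewrite !inE; case: (eqVneq z x) => [->|_]; first by rewrite xi.
  case: (eqVneq z y) => [->|_]; first by rewrite (negbTE yi).
  by case: (z \in N i).
apply/setP => z; rewrite !inE; case: (eqVneq z y) => [->|_]; first by rewrite yj orbT.
case: (eqVneq z x) => [->|_]; first by rewrite (negbTE xj).
by case: (z \in N j); rewrite ?orbT ?andbF.
Qed.

(** Otherwise [[set a; b]] hits once every set containing [a] or [b], and the two full loads give 3
    + 2(k - 2) <= k, which is absurd. *)
Lemma extremal_common a b : a \in M -> b \in M ->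
  exists i, [/\ i \in P, a \in N i & b \in N i].
Proof.
move=> aM bM.
case: (boolP [exists i in P, (a \in N i) && (b \in N i)]).
  by case/exists_inP => i iP /andP [ai bi]; exists i.
move/exists_inPn => nocommon.
have excl i : i \in P -> a \in N i -> b \in N i -> False.
  by move=> iP ai bi; have := nocommon i iP; rewrite ai bi.
(* The load k - 2 of [a] is positive, so some set contains [a]; it would be common if [a] and [b]
   coincided. *)
have ab : a != b.
  apply/eqP => ab; have := extremal_load aM.
  rewrite big1 => [|i /andP [iP ai]]; first by lia.
  by case: (excl i iP ai); rewrite -ab.
have := @unique_hits [set a; b] [set i in P | (a \in N i) || (b \in N i)].
rewrite cards2 ab => H.
have sumE : \sum_(i in [set i in P | (a \in N i) || (b \in N i)]) s i
    = \sum_(i in P | a \in N i) s i + \sum_(i in P | b \in N i) s i.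
  rewrite (bigID (fun i => a \in N i)) /=; congr (_ + _); apply: eq_bigl => i.
    by rewrite inE; case: (a \in N i); rewrite ?andbF ?andbT.
  rewrite inE; case: (boolP (i \in P)) => //= iP.
  case: (boolP (a \in N i)) => /= [ai|_]; last by rewrite andbT.
  by rewrite ?andbF; apply/esym/negP/(excl i iP ai).
suff : 1 + 2 + \sum_(i in [set i in P | (a \in N i) || (b \in N i)]) s i <= k.
  by rewrite sumE !extremal_load //; lia.
apply: H.
- by rewrite subUset !sub1set aM.
- by apply/subsetP => i; rewrite inE => /andP [].
move=> i; rewrite inE => /andP [iP abi]; apply/eqP/cards1P.
exists (if a \in N i then a else b); apply/setP => z; rewrite !inE.
case: (boolP (a \in N i)) abi => /= [ai _|ai bi].
  case: (eqVneq z a) => [->|_] /=; first by rewrite ai.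
  by case: (eqVneq z b) => [->|_]; rewrite ?andbF ?andbT //; apply/negP/(excl i iP ai).
case: (eqVneq z a) => [->|_] /=; first by rewrite (negbTE ai) (negbTE ab).
by case: (eqVneq z b) => [->|_]; rewrite ?andbF ?bi.
Qed.

(** Take [N i] of largest cardinality. If it missed some [b], a set joining [b] to an element of
    [N i] would be neither contained in [N i], nor larger, nor disjoint from it, against
    laminarity. *)
Lemma extremal_unique : exists2 i, P = [set i] & N i = M /\ s i = k - 2.
Proof.
have [a aM] : exists a, a \in M by apply/set0Pn; rewrite -card_gt0; lia.
have [i0 [i0P _ _]] := extremal_common aM aM.
have [i iP imax] := arg_maxnP (P := mem P) (fun i => #|N i|) i0P.
have {}iP : i \in P := iP.
have NiM : N i = M.
  apply/eqP; rewrite eqEsubset NM //=; apply/subsetP => b bM.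
  have /set0Pn [c ci] := N0 iP.
  have [j [jP cj bj]] := extremal_common (subsetP (NM iP) _ ci) bM.
  apply/negPn/negP => bi.
  have nji : ~~ (N j \subset N i) by apply/subsetPn; exists b.
  case: (boolP (N i \subset N j)) => [ij|nij].
    have /proper_card : N i \proper N j by rewrite properE ij.
    by have := imax j jP; rewrite /= leqNgt => /negbTE ->.
  have /pred0P /(_ c) := extremal_laminar iP jP nij nji.
  by rewrite /= ci cj.
have si : s i = k - 2 by have := extremal_card iP; rewrite NiM cardM; lia.
exists i => //; apply/setP => j; rewrite inE.
(* [N i] alone already uses the whole load k - 2 of each element, so a second member of positive
   multiplicity would overload one. *)
case: (eqVneq j i) => [->//|ji]; apply/negP => jP.
have /set0Pn [c cj] := N0 jP.
have ci : c \in N i by rewrite NiM (subsetP (NM jP)).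
have := load_bound c; rewrite (bigD1 i) ?iP ?ci //= (bigD1 j) ?jP ?cj //= si.
have := s_gt0 jP; lia.
Qed.
End Extremal.
End UniqueHits.
End SetFamilies.

(** * Rooted induced trees and connected components *)

Section Trees.
Variables (T : finType) (e : rel T).
Hypothesis e_sym : symmetric e.
Hypothesis e_irr : irreflexive e.

(** Induced trees containing [v], presented as grown leaf by leaf, so that gluing and pruning become
    inductions. *)
Inductive rtree (v : T) : {set T} -> Prop :=
| rtree1 : rtree v [set v]
| rtree_leaf R x y : rtree v R -> x \in R -> y \notin R -> e x y ->
    (forall z, z \in R -> e z y -> z = x) -> rtree v (y |: R).

Lemma rtree_root v (R : {set T}) : rtree v R -> v \in R.
Proof. by elim=> [|R' x y _ vR _ _ _ _]; rewrite !inE ?eqxx ?vR ?orbT. Qed.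

Lemma induced_rel_sym S : symmetric (induced_rel e S).
Proof. by move=> x y; rewrite /induced_rel /= e_sym; case: (x \in S); case: (y \in S). Qed.

Lemma induced_connectS (A B : {set T}) x y : A \subset B ->
  connect (induced_rel e A) x y -> connect (induced_rel e B) x y.
Proof.
move=> /subsetP AB; apply: connect_sub => a b /and3P [aA bA ab].
by apply: connect1; rewrite /induced_rel /= !AB.
Qed.

Lemma induced_connected_root (S : {set T}) v :
  (forall x, x \in S -> connect (induced_rel e S) v x) ->
  forall x y, x \in S -> y \in S -> connect (induced_rel e S) x y.
Proof.
move=> conn x y xS yS; apply: connect_trans (conn y yS).
by rewrite (sym_connect_sym (induced_rel_sym S)) conn.
Qed.

Lemma rtree_connected v (R : {set T}) : rtree v R ->
  forall x, x \in R -> connect (induced_rel e R) v x.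
Proof.
elim=> [x|R' x y _ IH xR yR xy _ z]; first by rewrite inE => /eqP ->; apply: connect0.
have sub : R' \subset y |: R' by apply: subsetU1.
have IH' u : u \in R' -> connect (induced_rel e (y |: R')) v u.
  by move=> uR; apply: induced_connectS sub (IH u uR).
rewrite !inE => /orP [/eqP ->|/IH' //].
by apply: connect_trans (IH' x xR) (connect1 _); rewrite /induced_rel /= !inE eqxx xR xy orbT.
Qed.

(** A cycle avoiding the last leaf lies in the smaller tree; one through the leaf would pass twice
    through its only neighbour. *)
Lemma rtree_acyclic v R : rtree v R -> acyclic_rel (induced_rel e R).
Proof.
elim=> [|R' x y _ IH xR yR xy xuniq] c c3; apply/negP => /andP [cyc uniqc].
  case: c c3 cyc uniqc => [|a [|b c]] //= _ /andP [/and3P [aS bS _] _].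
  by move: aS bS; rewrite !inE => /eqP -> /eqP ->; rewrite eqxx.
case: (boolP (y \in c)) => yc.
  have nbr z : z != y -> induced_rel e (y |: R') z y -> z = x.
    move=> zy /and3P [zR _ zy']; apply: xuniq zy'.
    by move: zR; rewrite !inE (negbTE zy).
  (* Rotate the cycle to start at [y]: its successor [a] and its predecessor [last b c'] must both
     be [x], contradicting distinctness. *)
  have [i [|a [|b c']] rotc] := rot_to yc.
  - by have := congr1 size rotc; rewrite size_rot /=; lia.
  - by have := congr1 size rotc; rewrite size_rot /=; lia.
  move: cyc uniqc; rewrite -(rot_uniq i) -(rot_cycle i) rotc.
  rewrite /cycle rcons_path => /andP [/andP [ya _] ly] /and3P [].
  rewrite !inE => /norP [yb /norP [yab yc']] /norP [ab ac'] _.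
  have ax : a = x by apply: nbr; rewrite 1?eq_sym // induced_rel_sym.
  have lbc : last b c' \in b :: c' by apply: mem_last.
  have lx : last b c' = x.
    apply: (nbr (last b c')) ly; apply: contraTneq lbc => ->.
    by rewrite inE negb_or yab.
  by move: lbc; rewrite lx -ax inE (negbTE ab) (negbTE ac').
have := IH c c3; rewrite /ucycleb uniqc andbT => /negP; apply.
have sub : {in c &, subrel (induced_rel e (y |: R')) (induced_rel e R')}.
  move=> a b ac bc /and3P []; rewrite !inE => aR bR ab.
  have ay : a != y by apply: contraNneq yc => <-.
  have by' : b != y by apply: contraNneq yc => <-.
  by move: aR bR; rewrite /induced_rel /= (negbTE ay) (negbTE by') /= ab => -> ->.
by apply: (sub_in_cycle (P := mem c) sub) cyc; apply/allP.
Qed.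

Lemma rtree_induced v R : rtree v R -> induced_tree e R.
Proof.
move=> tR; split; last exact: rtree_acyclic tR.
exact: induced_connected_root (rtree_connected tR).
Qed.

(** Growth adds one vertex at a time, so every intermediate size occurs. *)
Lemma rtree_sub v (R : {set T}) m : rtree v R -> 0 < m <= #|R| ->
  exists R' : {set T}, [/\ R' \subset R, rtree v R' & #|R'| = m].
Proof.
elim=> [|R' x y tR IH xR yR xy xuniq].
  by rewrite cards1 => m1; exists [set v]; rewrite cards1; split=> //; [left|lia].
rewrite cardsU1 yR => /andP [m0 mle].
have [mle'|mgt] := leqP m #|R'|.
  have [|R2 [sub t2 c2]] := IH; first by rewrite m0.
  by exists R2; split=> //; apply: subset_trans sub (subsetU1 _ _).
exists (y |: R'); split=> //; first by right with x.
by rewrite cardsU1 yR; lia.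
Qed.

(** Replay the growth of [Q] on top of [R]. Edges between the two sets have [a] as an end, so each
    new leaf keeps a single neighbour; the predecessor in the count is for the shared vertex [a]. *)
Lemma rtree_glue v a (R Q : {set T}) : rtree v R -> rtree a Q -> a \in R ->
  (forall x, x \in R -> x \in Q -> x = a) ->
  (forall x y, x \in R -> y \in Q -> e x y -> x = a \/ y = a) ->
  rtree v (R :|: Q) /\ #|R :|: Q| = #|R| + #|Q|.-1.
Proof.
move=> tR tQ aR; elim: tQ => [|Q' x y tQ IH xQ yQ xy xuniq] meet edges.
  by rewrite (setUidPl _) ?sub1set // cards1 addn0.
have aQ := rtree_root tQ.
have [||tRQ cRQ] := IH.
- by move=> z zR zQ; apply: meet; rewrite // !inE zQ orbT.
- by move=> z u zR uQ; apply: edges; rewrite // !inE uQ orbT.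
have yR : y \notin R.
  by apply: contraNN yQ => yR; rewrite (meet y yR) // !inE eqxx.
have yRQ : y \notin R :|: Q' by rewrite inE negb_or yR.
rewrite setUCA; split; last first.
  by rewrite !cardsU1 yRQ yQ cRQ (cardsD1 a Q') aQ; lia.
right with x => // [|z]; first by rewrite inE xQ orbT.
rewrite inE => /orP [zR zy|]; last exact: xuniq.
have [za|ya] := edges z y zR (setU11 _ _) zy; last by rewrite ya aQ in yQ.
by apply: xuniq zy; rewrite za.
Qed.

Lemma rtree_star v (A : {set T}) :
  (forall x, x \in A -> e v x) -> {in A &, forall x y, ~~ e x y} ->
  rtree v (v |: A) /\ #|v |: A| = #|A|.+1.
Proof.
move=> vA indep.
have vnA : v \notin A by apply/negP => /vA; rewrite e_irr.
split; last by rewrite cardsU1 vnA.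
have [n] := ubnP #|A|; elim: n A vA indep vnA => // n IH A vA indep vnA leAn.
have [->|[x xA]] := set_0Vmem A; first by rewrite setU0; left.
rewrite -(setD1K xA) setUCA; right with v.
- apply: IH => [y /setD1P [_ /vA] //|y z /setD1P [_ yA] /setD1P [_ zA]||].
  + exact: indep.
  + by rewrite inE (negbTE vnA) andbF.
  by move: leAn; rewrite (cardsD1 x) xA; lia.
- by rewrite setU11.
- by rewrite !inE eqxx orbF; apply: contraNneq vnA => <-.
- exact: vA.
by move=> z /setU1P [-> //|/setD1P [_ zA] zx]; have := indep z x zA xA; rewrite zx.
Qed.

Lemma components (X : {set T}) : exists P : {set {set T}},
  [/\ partition P X,
      forall C, C \in P -> {in C &, forall x y, connect (induced_rel e C) x y} &
      forall C x y, C \in P -> x \in C -> y \in X -> e x y -> y \in C].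
Proof.
pose r := connect (induced_rel e X).
have r_sym : symmetric r by apply: sym_connect_sym; apply: induced_rel_sym.
have PX : partition (equivalence_partition r X) X.
  apply: equivalence_partitionP => x y z _ _ _; split=> [|xy]; first exact: connect0.
  by apply/idP/idP; apply: connect_trans; rewrite // -/r r_sym.
exists (equivalence_partition r X); split=> // [C /imsetP [x xX ->]|C y z].
  set D := [set y in X | r x y].
  have xD : x \in D by rewrite inE xX; apply: connect0.
  suff root y : y \in D -> connect (induced_rel e D) x y.
    by move=> a b; apply: induced_connected_root root _ _.
  rewrite inE => /andP [_ xy].
  (* A path in [X] from [x] never leaves the class [D]: the vertices reachable inside [D] are closed
     under the edges of [X]. *)
  have cl : closed (induced_rel e X) [set y | connect (induced_rel e D) x y].
    apply: intro_closed; first by apply: sym_connect_sym; apply: induced_rel_sym.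
    move=> a b /and3P [aX bX ab]; rewrite !inE => xa.
    have ra : r x a.
      by apply: induced_connectS xa; apply/subsetP => ?; rewrite inE => /andP [].
    apply: connect_trans xa (connect1 _); rewrite /induced_rel /= !inE aX bX ra ab /= andbT.
    by apply: connect_trans ra (connect1 _); rewrite /induced_rel /= aX bX.
  have := closed_connect cl xy; rewrite !inE => <-; exact: connect0.
case/imsetP => x xX ->; rewrite !inE => /andP [yX xy] zX yz; rewrite zX /=.
by apply: connect_trans xy (connect1 _); rewrite /induced_rel /= yX zX.
Qed.
End Trees.

(** * Inverse of the triangular numbers *)

Lemma triangular_root_exists n : exists s, 2 * n <= s * s.+1.
Proof. by exists n.*2; nia. Qed.

Definition triangular_root n := ex_minn (triangular_root_exists n).

Lemma triangular_rootP n : 2 * n <= triangular_root n * (triangular_root n).+1.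
Proof. by rewrite /triangular_root; case: ex_minnP. Qed.

Lemma triangular_root_gt0 n : 0 < n -> 0 < triangular_root n.
Proof. by have := triangular_rootP n; case: (triangular_root n) => //; lia. Qed.

(** Minimality, in the form that makes a graph on n + 1 vertices exceed the order bound for trees on
    at most [triangular_root n] vertices. *)
Lemma triangular_root_min n : 0 < n ->
  (triangular_root n - 1) * triangular_root n < 2 * n.
Proof.
move=> n0; have := triangular_root_gt0 n0.
rewrite /triangular_root; case: ex_minnP => s _ smin s0.
rewrite ltnNge; apply/negP => le; have := smin (s - 1); nia.
Qed.

(** * The order bound for rooted triangle-free graphs *)

Section Rooted.
Variables (T : finType) (e : rel T).
Hypothesis e_sym : symmetric e.
Hypothesis e_irr : irreflexive e.
Hypothesis e_tri : triangle_free e.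

(** Relative to a vertex set [S] of a fixed type, so that the induction passes to subgraphs without
    changing the type. *)
Definition rooted_graph (k : nat) (S : {set T}) (v : T) :=
  [/\ v \in S, forall x, x \in S -> connect (induced_rel e S) v x &
      forall R : {set T}, R \subset S -> rtree e v R -> #|R| <= k].

(* [levelled k S v l] says that [l] identifies the subgraph induced by [S] with
   G_k, [l x] being the index of the vertex of the path of which [x] is a copy. *)
Definition levelled (k : nat) (S : {set T}) (v : T) (l : T -> nat) :=
  [/\ forall x, x \in S -> (l x == 0) = (x == v),
      forall i, 0 < i -> #|[set x in S | l x == i]| = k - i &
      {in S &, forall x y, e x y = ((l x).+1 == l y) || ((l y).+1 == l x)}].

Definition order_bound (k : nat) (S : {set T}) (v : T) :=
  2 * #|S| <= 2 + k * (k - 1) /\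
  (2 * #|S| = 2 + k * (k - 1) -> exists l, levelled k S v l).

Lemma nbrs_indep a x y : e a x -> e a y -> ~~ e x y.
Proof.
move=> ax ay; apply/negP => xy; apply: (e_tri (x := a) (y := x) (z := y)).
by rewrite ax xy e_sym ay.
Qed.

(** * The induction step: removing the root and its neighbours *)

Section Step.
Variables (k : nat) (S : {set T}) (v : T) (P : {set {set T}}).
Let N := [set x in S | e v x].
Let X := (S :\ v) :\: N.
Hypothesis Sv : rooted_graph k S v.
Hypothesis IH : forall k' (S' : {set T}) v',
  #|S'| < #|S| -> rooted_graph k' S' v' -> order_bound k' S' v'.
Hypothesis PX : partition P X.
Hypothesis P_conn : forall C : {set T}, C \in P ->
  {in C &, forall x y, connect (induced_rel e C) x y}.
Hypothesis P_closed : forall (C : {set T}) x y, C \in P -> x \in C -> y \in X -> e x y -> y \in C.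

Definition attachment (C : {set T}) := [set a in N | [exists c in C, e a c]].
Let s (C : {set T}) := triangular_root #|C|.

Lemma in_part (C : {set T}) x : C \in P -> x \in C -> [/\ x \in S, x != v, x \notin N & ~~ e v x].
Proof.
move=> CP xC; have : x \in X by rewrite -(cover_partition PX); apply/bigcupP; exists C.
by rewrite /X /N !inE => /and3P [+ -> xS]; rewrite xS.
Qed.

Lemma in_nbr a : a \in N -> [/\ a \in S, a != v & e v a].
Proof.
by rewrite inE => /andP [aS va]; split=> //; apply: contraTneq va => ->; rewrite e_irr.
Qed.

Lemma part_eq (C D : {set T}) x : C \in P -> D \in P -> x \in C -> x \in D -> C = D.
Proof.
move=> CP DP xC xD; have /and3P [_ /trivIsetP tP _] := PX.
apply/eqP/negPn/negP => /(tP _ _ CP DP) /pred0P /(_ x).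
by rewrite /= xC xD.
Qed.

Lemma part_edge (C D : {set T}) x y : C \in P -> D \in P -> x \in C -> y \in D -> e x y -> C = D.
Proof.
move=> CP DP xC yD xy; apply: (part_eq CP DP (x := y)) => //.
apply: P_closed xy => //.
by rewrite -(cover_partition PX); apply/bigcupP; exists D.
Qed.

Lemma attach_nbr (C : {set T}) a x : C \in P -> x \in C -> a \in N -> e a x -> a \in attachment C.
Proof. by move=> CP xC aN ax; rewrite inE aN; apply/exists_inP; exists x. Qed.

Lemma part_neq0 C : C \in P -> 0 < #|C|.
Proof.
move=> CP; have /and3P [_ _ P0] := PX.
by rewrite card_gt0; apply: contraNneq P0 => <-.
Qed.

(** Without attachments [C] would be closed under the edges of [S], although [v] lies outside it and
    reaches all of [S]. *)
Lemma attach_neq0 C : C \in P -> attachment C != set0.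
Proof.
move=> CP; apply/negP => /eqP NC0.
have [vS Sconn _] := Sv.
have /card_gt0P [x xC] := part_neq0 CP.
have cl : closed (induced_rel e S) C.
  apply: intro_closed; first exact/sym_connect_sym/induced_rel_sym.
  move=> a b /and3P [aS bS ab] aC.
  case: (boolP (b \in N)) => [bN|bN].
    have := attach_nbr CP aC bN; rewrite NC0 inE e_sym ab.
    by move=> /(_ isT).
  apply: (P_closed CP aC _ ab); rewrite /X in_setD bN !inE bS andbT.
  by apply: contraTneq ab => ->; have [_ _ _] := in_part CP aC; rewrite e_sym.
have [xS xv _ _] := in_part CP xC.
have := closed_connect cl (Sconn x xS); rewrite xC => vC.
by have [_] := in_part CP vC; rewrite eqxx.
Qed.

Lemma attach_connected (C : {set T}) a : C \in P -> a \in attachment C ->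
  forall x, x \in a |: C -> connect (induced_rel e (a |: C)) a x.
Proof.
move=> CP; rewrite inE => /andP [aN /exists_inP [c cC ac]] x.
rewrite in_setU1 => /orP [/eqP -> |xC]; first exact: connect0.
apply: connect_trans (connect1 _) (induced_connectS (subsetU1 _ _) (P_conn CP cC xC)).
by rewrite /induced_rel /= !inE eqxx cC ac orbT.
Qed.

Lemma attach_card_lt (C : {set T}) a : C \in P -> a \in attachment C -> #|a |: C| < #|S|.
Proof.
move=> CP; rewrite inE => /andP [aN _]; have [aS av _] := in_nbr aN.
have [vS _ _] := Sv.
apply/proper_card/properP; split.
  by apply/subsetP => x /setU1P [->//|xC]; have [] := in_part CP xC.
exists v => //; rewrite !inE negb_or eq_sym av; apply/negP => vC.
by have [_] := in_part CP vC; rewrite eqxx.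
Qed.

Lemma attach_notin (C : {set T}) a : C \in P -> a \in N -> a \notin C.
Proof. by move=> CP aN; apply/negP => /(in_part CP) []; rewrite aN. Qed.

(** If there is no such tree, pruning shows that all trees at [a] in [a |: C] have at most [s C]
    vertices. The induction hypothesis then bounds [#|C|] below what the minimality of [s C]
    allows. *)
Lemma attach_tree (C : {set T}) a : C \in P -> a \in attachment C ->
  exists Q : {set T}, [/\ Q \subset a |: C, rtree e a Q & #|Q| = (s C).+1].
Proof.
move=> CP aC; apply: Classical_Prop.NNPP => noQ.
have aN : a \in N by move: aC; rewrite inE => /andP [].
have C0 := part_neq0 CP.
have [|le _] := @IH (s C) (a |: C) a (attach_card_lt CP aC).
  split; [exact: setU11|exact: attach_connected|move=> R RC tR].
  rewrite leqNgt; apply/negP => ltR; apply: noQ.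
  have [|Q [QR tQ cQ]] := rtree_sub (m := (s C).+1) tR; first by rewrite ltR.
  by exists Q; split=> //; apply: subset_trans QR RC.
move: le; rewrite cardsU1 attach_notin // mulnC.
have := triangular_root_min C0; rewrite -/(s C); lia.
Qed.

(** Start from the star on [v |: A] and glue in one tree per component at its unique attachment in
    [A]. No other vertex built so far has a neighbour in that component. *)
Lemma unique_attach_trees (A : {set T}) (J : seq {set T}) :
  A \subset N -> uniq J -> {subset J <= P} ->
  (forall C, C \in J -> #|attachment C :&: A| = 1) ->
  exists R : {set T}, [/\ rtree e v R, v |: A \subset R,
    forall x, x \in R -> x \in v |: A \/ exists2 C, C \in J & x \in C &
    #|R| = 1 + #|A| + \sum_(C <- J) s C].
Proof.
move=> /subsetP AN; elim: J => [|C J IHJ] /=.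
  move=> _ _ _; have [||tA cA] := @rtree_star _ _ e_irr v A.
  - by move=> x /AN /in_nbr [].
  - by move=> x y /AN /in_nbr [_ _ vx] /AN /in_nbr [_ _ vy]; apply: nbrs_indep vx vy.
  by exists (v |: A); split=> // [x xA|]; [left|rewrite big_nil addn0 cA].
case/andP => CJ uJ JP Juniq.
have CP : C \in P by rewrite JP ?mem_head.
have [//|D DJ|D DJ|R [tR AR RJ cR]] := IHJ.
- by apply: JP; rewrite inE DJ orbT.
- by apply: Juniq; rewrite inE DJ orbT.
have /eqP/cards1P [a Ca] := Juniq C (mem_head _ _).
have [aC aA] : a \in attachment C /\ a \in A.
  by apply/setIP; rewrite Ca set11.
have [Q [QC tQ cQ]] := attach_tree CP aC.
have aR : a \in R by rewrite (subsetP AR) // !inE aA orbT.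
have RC x : x \in R -> x \notin C.
  move=> /RJ [/setU1P [->|/AN xN]|[D DJ xD]].
  - by apply/negP => /(in_part CP) []; rewrite eqxx.
  - exact: attach_notin.
  have DP : D \in P by apply: JP; rewrite inE DJ orbT.
  by apply: contraNN CJ => xC; rewrite (part_eq CP DP xC xD).
have [||tRQ cRQ] := rtree_glue tR tQ aR.
- by move=> x xR /(subsetP QC) /setU1P [//|xC]; rewrite (negbTE (RC x xR)) in xC.
- move=> x y xR /(subsetP QC) /setU1P [->|yC] xy; [by right|left].
  case: (RJ x xR) => [/setU1P [xv|xA]|[D DJ xD]].
  + by have [_ _ _] := in_part CP yC; rewrite -xv xy.
  + apply/set1P; rewrite -Ca inE xA andbT.
    exact: attach_nbr (AN _ xA) xy.
  have DP : D \in P by apply: JP; rewrite inE DJ orbT.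
  by rewrite -(part_edge DP CP xD yC xy) DJ in CJ.
exists (R :|: Q); split=> //.
- exact: subset_trans AR (subsetUl _ _).
- move=> x /setUP [/RJ [xA|[D DJ xD]]|/(subsetP QC) /setU1P [->|xC]].
  + by left.
  + by right; exists D; rewrite // inE DJ orbT.
  + by left; rewrite !inE aA orbT.
  by right; exists C; rewrite ?mem_head.
by rewrite cRQ cR cQ big_cons; lia.
Qed.

Lemma unique_attach_bound (A : {set T}) (J : {set {set T}}) :
  A \subset N -> J \subset P ->
  (forall C, C \in J -> #|attachment C :&: A| = 1) ->
  1 + #|A| + \sum_(C in J) s C <= k.
Proof.
move=> AN /subsetP JP Juniq; have [vS _ Sk] := Sv.
have [|||R [tR _ RJ cR]] := @unique_attach_trees A (enum J) AN.
- exact: enum_uniq.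
- by move=> C; rewrite mem_enum => /JP.
- by move=> C; rewrite mem_enum => /Juniq.
rewrite -big_enum -cR; apply: Sk tR.
apply/subsetP => x /RJ [/setU1P [->//|/(subsetP AN) /in_nbr []//]|[C]].
by rewrite mem_enum => /JP CP /(in_part CP) [].
Qed.

Lemma attach_sub C : C \in P -> attachment C \subset N.
Proof. by move=> _; apply/subsetP => a; rewrite inE => /andP []. Qed.

Lemma card_decomp : #|S| = 1 + #|N| + \sum_(C in P) #|C|.
Proof.
have [vS _ _] := Sv.
rewrite -(card_partition PX) (cardsD1 v) vS -addnA; congr (_ + _).
rewrite -(cardsID N (S :\ v)); congr (_ + _); congr #|pred_of_set _|.
apply/setIidPr/subsetP => a aN; have [aS av _] := in_nbr aN.
by rewrite !inE av aS.
Qed.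

Lemma part_weight : \sum_(C in P) 2 * #|C| <= \sum_(C in P) s C * (s C).+1.
Proof. by apply: leq_sum => C _; apply: triangular_rootP. Qed.

(** The root, its neighbours and the components contribute at most 2, 2(k - 1) and (k - 2)(k - 1) to
    the doubled order. *)
Lemma step_bound : 2 * #|S| <= 2 + k * (k - 1).
Proof.
have := part_weight; have := weight_bound attach_sub attach_neq0 unique_attach_bound.
have := card_ground unique_attach_bound.
rewrite card_decomp -big_distrr /=; nia.
Qed.

Lemma step_eq : 2 * #|S| = 2 + k * (k - 1) ->
  [/\ 0 < k, #|N| = k - 1, \sum_(C in P) 2 * #|C| = (k - 2) * (k - 1) &
      \sum_(C in P) s C * (s C).+1 = (k - 2) * (k - 1)].
Proof.
have [vS _ Sk] := Sv.
have k0 : 0 < k by have := Sk [set v]; rewrite sub1set cards1; apply=> //; left.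
have := part_weight; have := weight_bound attach_sub attach_neq0 unique_attach_bound.
have := card_ground unique_attach_bound.
rewrite card_decomp -big_distrr /= => le1 le2 le3 eqS.
by split; nia.
Qed.

(** Here (k - 2)(k - 1) vanishes, so there are no components and the graph is a star at [v]. *)
Lemma small_levels : k <= 2 -> 2 * #|S| = 2 + k * (k - 1) -> exists l, levelled k S v l.
Proof.
move=> k2 /step_eq [k0 cN sumP _].
have [vS _ _] := Sv.
have SE x : x \in S -> x != v -> x \in N.
  move=> xS xv; apply/negPn/negP => xN.
  have : x \in cover P by rewrite (cover_partition PX) in_setD xN !inE xv.
  case/bigcupP => C CP xC; have := part_neq0 CP.
  by move: sumP; rewrite (bigD1 C) //=; nia.
exists (fun x => x != v : nat); split=> [x _|i i0|x y xS yS].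
- by case: (x == v).
- case: (eqVneq i 1) => [->|i1].
    rewrite -cN; apply: eq_card => x; rewrite !inE eqb1.
    apply/andP/andP => [[xS xv]|[xS vx]]; first by have := SE x xS xv; rewrite inE => /andP.
    by split=> //; apply: contraTneq vx => ->; rewrite e_irr.
  rewrite (_ : [set x in S | _] = set0) ?cards0; first by lia.
  apply/setP => x; rewrite !inE; case: (x == v); rewrite /= ?andbF //; last by lia.
  by rewrite eq_sym ?(negbTE i1) ?andbF //; lia.
case: (eqVneq x v) => [->|xv]; case: (eqVneq y v) => [->|yv] /=.
- by rewrite e_irr.
- by have [_ _ ->] := in_nbr (SE y yS yv).
- by rewrite e_sym; have [_ _ ->] := in_nbr (SE x xS xv).
apply/negbTE; apply: (@nbrs_indep v).
  by have [] := in_nbr (SE x xS xv).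
by have [] := in_nbr (SE y yS yv).
Qed.

(** * Equality with a single component attached to all neighbours of the root *)

Section OnePart.
Variable C : {set T}.
Hypothesis k_gt2 : 2 < k.
Hypothesis PC : P = [set C].
Hypothesis attachC : attachment C = N.
Hypothesis cardN : #|N| = k - 1.
Hypothesis cardC : 2 * #|C| = (k - 2) * (k - 1).

Let CP : C \in P. Proof. by rewrite PC set11. Qed.

(** A tree at [w] in [w |: C] extends by [v], which is adjacent to [w] alone. Hence the tree bound
    drops to k - 1, and [w |: C] meets the resulting order bound with equality. *)
Lemma nbr_levels w : w \in N -> exists l, levelled (k - 1) (w |: C) w l.
Proof.
move=> wN; have wA : w \in attachment C by rewrite attachC.
have [wS wv vw] := in_nbr wN; have [vS _ Sk] := Sv.
have wC := attach_notin CP wN.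
have [|_] := @IH (k - 1) (w |: C) w (attach_card_lt CP wA).
  split; [exact: setU11|exact: attach_connected|move=> R RC tR].
  have [||tw cw] := @rtree_star _ _ e_irr v [set w].
  - by move=> x /set1P ->.
  - by move=> x y /set1P -> /set1P ->; rewrite e_irr.
  have wvw : w \in v |: [set w] by rewrite !inE eqxx orbT.
  have nvR : v \notin R.
    apply/negP => /(subsetP RC) /setU1P [vw'|vC]; first by rewrite vw' eqxx in wv.
    by have [_] := in_part CP vC; rewrite eqxx.
  have [||tR' cR'] := rtree_glue tw tR wvw.
  - by move=> x /set2P [->|->] // vR; rewrite vR in nvR.
  - move=> x y /set2P [->|->]; last by left.
    move=> /(subsetP RC) /setU1P [->|yC vy]; first by right.
    by have [_ _ _] := in_part CP yC; rewrite vy.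
  have := Sk _ _ tR'; rewrite cR' cw cards1 => le.
  suff : 2 + #|R|.-1 <= k by case: #|R| => [|n]; clear -k_gt2; lia.
  apply: le; apply/subsetP => x /setUP [/set2P [->|->] //|/(subsetP RC)].
  by case/setU1P => [->//|/(in_part CP) []].
by apply; rewrite cardsU1 wC; nia.
Qed.

(** Facts about levels 1 and 2 phrased without the level function, so that they can be compared for
    two roots [w]. *)
Lemma nbr_structure w : w \in N ->
  [/\ #|[set y in C | e w y]| = k - 2,
      forall y, y \in C -> e w y -> #|[set z in C | e y z]| = k - 3 &
      forall x y z, x \in C -> y \in C -> z \in C ->
        e w x -> e w y -> e y z -> e z x].
Proof.
move=> wN; have [l [l0 lk le]] := nbr_levels wN.
have wC := attach_notin CP wN.
have lw : l w = 0 by apply/eqP; rewrite l0 ?setU11.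
have sub x : x \in C -> x \in w |: C by move=> xC; rewrite !inE xC orbT.
have l_neq0 x : x \in C -> l x != 0.
  by move=> xC; rewrite l0 ?sub //; apply: contraNneq wC => <-.
have ew x : x \in C -> e w x = (l x == 1).
  by move=> xC; rewrite le ?setU11 ?sub // lw orbF eq_sym.
have lev i : 0 < i -> #|[set x in C | l x == i]| = k - 1 - i.
  move=> i0; rewrite -lk //; apply: eq_card => x; rewrite !inE.
  by case: (eqVneq x w) => [->|//]; rewrite (negbTE wC) lw /=; lia.
have ey y z : y \in C -> z \in C -> e w y -> e y z = (l z == 2).
  move=> yC zC; rewrite ew // => /eqP ly; have := l_neq0 z zC.
  by rewrite le ?sub // ly; lia.
split=> [|y yC wy|x y z xC yC zC wx wy yz].
- rewrite (_ : [set y in C | _] = [set x in C | l x == 1]) ?lev //; first by lia.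
  by apply/setP => x; rewrite !inE; case: (boolP (x \in C)) => //= /ew ->.
- rewrite (_ : [set z in C | _] = [set x in C | l x == 2]) ?lev //; first by lia.
  by apply/setP => x; rewrite !inE; case: (boolP (x \in C)) => //= xC; rewrite (ey y).
by move: yz wx; rewrite (ey y) // ew // le ?sub // => /eqP -> /eqP ->.
Qed.

(* Otherwise [v], [w], [w'], [y] and the neighbours of [y] in [C] form a tree on
   [k + 1] vertices. *)
Lemma nbrs_twins w w' y : w \in N -> w' \in N -> y \in C -> e w y -> e w' y.
Proof.
move=> wN w'N yC wy; apply/negPn/negP => w'y.
have [cw cwy wcomp] := nbr_structure wN.
have [_ cw'y _] := nbr_structure w'N.
have [wS wv vw] := in_nbr wN; have [w'S w'v vw'] := in_nbr w'N.
have [vS _ Sk] := Sv; have [yS yv yN vy] := in_part CP yC.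
have ww' : w != w' by apply: contraNneq w'y => <-.
set B := [set z in C | e y z].
have BC z : z \in B -> z \in C /\ e y z by rewrite inE => /andP.
have w'B z : z \in B -> ~~ e w' z.
  move=> /BC [zC yz]; apply/negP => w'z.
  (* If [w'] were adjacent to [z], then [z] would have k - 3 neighbours in [C]; seen from [w], it is
     adjacent to all k - 2 neighbours of [w] there. *)
  suff : k - 2 <= k - 3 by clear -k_gt2; lia.
  rewrite -{1}cw -(cw'y z zC w'z); apply/subset_leq_card/subsetP => x; rewrite !inE => /andP [xC wx].
  by rewrite xC (wcomp x y).
have [||tA cA] := @rtree_star _ _ e_irr v [set w; w'].
- by move=> x /set2P [] ->.
- by move=> x z /set2P [] -> /set2P [] ->; apply: (@nbrs_indep v).
have [||tB cB] := @rtree_star _ _ e_irr y B.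
- by move=> x /BC [].
- by move=> x z /BC [_ yx] /BC [_ yz]; apply: nbrs_indep yx yz.
have yA : y \notin v |: [set w; w'].
  rewrite !inE !negb_or yv /=; apply/andP.
  by split; apply: contraNneq yN => ->.
have tR : rtree e v (y |: (v |: [set w; w'])).
  right with w => //; first by rewrite !inE eqxx orbT.
  by move=> z /setU1P [->|/set2P [->|->]] //; rewrite ?(negbTE vy) ?(negbTE w'y).
have [|||tRB cRB] := rtree_glue tR tB; first exact: setU11.
- move=> x /setU1P [//|xA] /setU1P [//|/BC [xC _]].
  move: xA => /setU1P [xv|/set2P [] xw].
  + by have [_] := in_part CP xC; rewrite xv eqxx.
  + by have := attach_notin CP wN; rewrite -xw xC.
  by have := attach_notin CP w'N; rewrite -xw xC.
- move=> x z /setU1P [->|xA] /setU1P [->|zB]; try by [left|right].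
  have [zC yz] := BC z zB; move: xA => /setU1P [->|/set2P [] ->] xz.
  + by have [_ _ _] := in_part CP zC; rewrite xz.
  + by have := nbrs_indep wy xz; rewrite yz.
  by have := w'B z zB; rewrite xz.
have : #|(y |: (v |: [set w; w'])) :|: (y |: B)| <= k.
  apply: Sk tRB; apply/subsetP => x /setUP [|/setU1P [->//|/BC [/(in_part CP) [] //]]].
  by move=> /setU1P [->//|/setU1P [->//|/set2P [] ->]].
rewrite cRB cB cardsU1 yA cA cards2 ww' cwy //; clear -k_gt2; lia.
Qed.

Lemma one_part_levels : exists l, levelled k S v l.
Proof.
have [w0 w0N] : exists w, w \in N by apply/set0Pn; rewrite -card_gt0; lia.
have [l [l0 lk le]] := nbr_levels w0N.
have wC := attach_notin CP w0N.
have [vS _ _] := Sv.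
have lw : l w0 = 0 by apply/eqP; rewrite l0 ?setU11.
have sub x : x \in C -> x \in w0 |: C by move=> xC; rewrite !inE xC orbT.
have l_neq0 x : x \in C -> l x != 0.
  by move=> xC; rewrite l0 ?sub //; apply: contraNneq wC => <-.
have eN w x : w \in N -> x \in C -> e w x = (l x == 1).
  move=> wN xC; rewrite (_ : e w x = e w0 x); last by apply/idP/idP; apply: nbrs_twins.
  by rewrite le ?setU11 ?sub // lw orbF eq_sym.
have SP x : x \in S -> [\/ x = v, x \in N | x \in C].
  move=> xS; case: (eqVneq x v) => [->|xv]; first by constructor 1.
  case: (boolP (x \in N)) => [xN|xN]; first by constructor 2.
  constructor 3; have : x \in cover P by rewrite (cover_partition PX) in_setD xN !inE xv.
  by rewrite PC /cover big_set1.
(* The levels of [w0 |: C] move up by one, and all of [N] joins [w0] at level 1; this is consistent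
   because the neighbours of [v] are twins towards [C]. *)
pose L x := if x == v then 0 else if x \in N then 1 else (l x).+1.
have Lv : L v = 0 by rewrite /L eqxx.
have LN x : x \in N -> L x = 1.
  by move=> xN; rewrite /L xN; have [_ /negbTE ->] := in_nbr xN.
have LC x : x \in C -> L x = (l x).+1.
  by move=> /(in_part CP) [_ /negbTE xv /negbTE xN _]; rewrite /L xv xN.
have vC x : x \in C -> e v x = false by move=> /(in_part CP) [_ _ _ /negbTE].
exists L; split.
- move=> x /SP [->|xN|xC]; first by rewrite Lv !eqxx.
    by rewrite LN //; have [_ /negbTE ->] := in_nbr xN.
  by rewrite LC //; have [_ /negbTE ->] := in_part CP xC.
- move=> [//|[_|i _]].
    rewrite -cardN; apply: eq_card => x; rewrite [in LHS]inE.
    apply/andP/idP => [[/SP [->|//|xC]]|xN]; first by rewrite Lv.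
      by rewrite LC // eqSS (negbTE (l_neq0 x xC)).
    by rewrite LN //; have [] := in_nbr xN.
  rewrite (_ : k - i.+2 = k - 1 - i.+1); last by lia.
  rewrite -lk //; apply: eq_card => x; rewrite !inE.
  apply/andP/andP => [[/SP [->|/LN ->|xC]]|[]]; first by rewrite Lv.
  - by [].
  - by rewrite LC // xC orbT eqSS.
  move=> /orP [/eqP -> |xC]; first by rewrite lw.
  by rewrite LC // eqSS => ->; have [] := in_part CP xC.
move=> x y /SP [->|xN|xC] /SP [->|yN|yC]; rewrite ?Lv.
- by rewrite e_irr.
- by rewrite LN //; have [_ _ ->] := in_nbr yN.
- by rewrite vC // LC // eqSS [0 == _]eq_sym (negbTE (l_neq0 y yC)).
- by rewrite LN // e_sym; have [_ _ ->] := in_nbr xN.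
- rewrite !LN //; have [_ _ vx] := in_nbr xN; have [_ _ vy] := in_nbr yN.
  exact/negbTE/(nbrs_indep vx vy).
- by rewrite eN // (LN x xN) (LC y yC) !eqSS orbF eq_sym.
- by rewrite e_sym vC // LC // eqSS [0 == _]eq_sym (negbTE (l_neq0 x xC)).
- by rewrite e_sym eN // (LN y yN) (LC x xC) !eqSS [1 == _]eq_sym.
by rewrite le ?sub // !LC.
Qed.
End OnePart.

Lemma step_levels : 2 * #|S| = 2 + k * (k - 1) -> exists l, levelled k S v l.
Proof.
have [k2|k2] := leqP k 2; first exact: small_levels.
move=> /step_eq [_ cN sumC sumS].
have s_gt0 C : C \in P -> 0 < s C by move=> /part_neq0 /triangular_root_gt0.
have [C PC [NC sC]] :=
  extremal_unique attach_sub attach_neq0 unique_attach_bound k2 cN sumS s_gt0.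
apply: (@one_part_levels C) => //.
by rewrite -sumC PC big_set1.
Qed.
End Step.

Lemma rooted_order_bound k S v : rooted_graph k S v -> order_bound k S v.
Proof.
have [n] := ubnP #|S|; elim: n k S v => // n IHn k S v leSn Sv.
have IH k' (S' : {set T}) v' : #|S'| < #|S| -> rooted_graph k' S' v' -> order_bound k' S' v'.
  by move=> ltS; apply: IHn; lia.
have [P [PX Pconn Pclosed]] := components e_sym ((S :\ v) :\: [set x in S | e v x]).
by split; [apply: step_bound Sv IH PX Pconn Pclosed|apply: step_levels Sv IH PX Pconn Pclosed].
Qed.
End Rooted.

(** * From a level function to an isomorphism with G_k *)

Lemma levelled_gk (k : nat) (T : finType) (e : rel T) (v : T) (l : T -> nat) :
  0 < k -> levelled e k [set: T] v l ->
  exists f : T -> gk_vert k,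
    [/\ bijective f, forall x y, e x y = gk_adj (f x) (f y),
        nat_of_ord (val (f v)).1 = 0 & nat_of_ord (val (f v)).2 = 0].
Proof.
case: k => // k _ [l0 lk le].
(* A vertex is sent to its level paired with its position in the enumeration of that level. *)
pose lev i := enum [set x | l x == i].
have levE i : 0 < i -> size (lev i) = k.+1 - i.
  by move=> i0; rewrite -cardE -lk //; apply: eq_card => x; rewrite !inE.
have lev0 : lev 0 = [:: v].
  by rewrite /lev (_ : [set x | _] = [set v]) ?enum_set1 //; apply/setP => x; rewrite !inE l0 ?inE.
have mem_lev x i : (x \in lev i) = (l x == i) by rewrite mem_enum inE.
have idx x : index x (lev (l x)) < size (lev (l x)) by rewrite index_mem mem_lev.
(* The level of [x] contains [x], so its size [k.+1 - l x] is positive when [l x] is. *)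
have lt_l x : l x < k.+1.
  by have := idx x; case: (posnP (l x)) => [->//|l_gt0]; rewrite levE //; lia.
have lt_i x : index x (lev (l x)) < k.+1.
  by have := idx x; case: (posnP (l x)) => [->|l_gt0]; rewrite ?lev0 ?levE //=; lia.
have ok x : @gk_ok k.+1 (inord (l x), inord (index x (lev (l x)))).
  rewrite /gk_ok /= !inordK //.
  have := idx x; case: (posnP (l x)) => [->|l_gt0]; rewrite ?lev0 ?levE //=; lia.
pose f x : gk_vert k.+1 := Sub _ (ok x).
have f1 x : (val (f x)).1 = l x :> nat by rewrite SubK /= inordK.
have f2 x : (val (f x)).2 = index x (lev (l x)) :> nat by rewrite SubK /= inordK.
exists f; split=> [|x y||].
- apply: inj_card_bij.
    move=> x y fxy; have lxy : l x = l y by rewrite -!f1 fxy.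
    have : index x (lev (l x)) = index y (lev (l y)) by rewrite -!f2 fxy.
    rewrite lxy => ixy; rewrite -(nth_index v (s := lev (l y)) (x := x)) ?mem_lev ?lxy //.
    by rewrite ixy nth_index ?mem_lev.
  (* The map back is injective too, which supplies the cardinality comparison making the injective
     [f] bijective. *)
  pose g (p : gk_vert k.+1) := nth v (lev (val p).1) (val p).2.
  have gok (p : gk_vert k.+1) : (val p).2 < size (lev (val p).1).
    have := valP p; rewrite /gk_ok; case: eqP => [->/eqP ->|/eqP]; first by rewrite lev0.
    by rewrite -lt0n => p0; rewrite levE.
  have lg p : l (g p) = (val p).1 by apply/eqP; rewrite -mem_lev mem_nth.
  apply: (@leq_card _ _ g) => p q gpq.
  have pq1 : (val p).1 = (val q).1 by apply: val_inj; rewrite /= -!lg gpq.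
  have /eqP := gpq; rewrite /g pq1 nth_uniq ?enum_uniq ?gok // => [/eqP pq2|]; last first.
    by rewrite -pq1 gok.
  by apply: val_inj; rewrite [LHS]surjective_pairing [RHS]surjective_pairing pq1 (val_inj pq2).
- by rewrite /gk_adj !f1 le ?inE.
- by rewrite f1; apply/eqP; rewrite l0 ?inE.
by rewrite f2 (eqP (_ : l v == 0)) ?l0 ?inE // lev0 /= eqxx.
Qed.

Theorem theorem1 (k : nat) (T : finType) (e : rel T) (v : T) :
  1 <= k ->
  simple_graph e -> connected_graph e -> triangle_free e ->
  ~ (exists S : {set T}, [/\ #|S| = k.+1, v \in S & induced_tree e S]) ->
  #|T| <= 1 + (k - 1) * k %/ 2 /\
  (#|T| = 1 + (k - 1) * k %/ 2 ->
   exists f : T -> gk_vert k,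
     [/\ bijective f,
         forall x y, e x y = gk_adj (f x) (f y),
         nat_of_ord (val (f v)).1 = 0 &
         nat_of_ord (val (f v)).2 = 0]).
Proof.
move=> k0 [e_sym e_irr] conn tri notree.
have rooted : rooted_graph e k [set: T] v.
  split=> [|x _|R _ tR]; rewrite ?inE //.
    by apply: connect_sub (conn v x) => a b ab; apply: connect1; rewrite /induced_rel /= !inE.
  (* A tree with more than [k] vertices is pruned to exactly [k.+1], the size that is excluded. *)
  rewrite leqNgt; apply/negP => ltR; apply: notree.
  have [|Q [_ tQ cQ]] := rtree_sub (m := k.+1) tR; first by rewrite ltR.
  by exists Q; split=> //; [apply: rtree_root tQ|apply: rtree_induced tQ].
have [le levels] := rooted_order_bound e_sym e_irr tri rooted.
(* A product of consecutive integers is even, so the halved bound matches the doubled one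
   exactly. *)
have even_k : (k - 1) * k = 2 * ((k - 1) * k %/ 2).
  rewrite [RHS]mulnC divnK // dvdn2 oddM oddB //; by case: (odd k).
rewrite cardsT in le levels.
split=> [|cT]; first by lia.
by have [|l] := levels; [lia|apply: levelled_gk].
Qed.
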